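(* Let $(R,\mathfrak{m})$ be a commutative noetherian local ring, let $I,J$ be ideals of $R$ and let $M$ be an $R$-module. Then for every integer $j$, $$H^i_I\big(\mathfrak{F}^I_{j,J}(M)\big)\cong\begin{cases}0 & i\neq 0,\\ \mathfrak{F}^I_{j,J}(M) & i=0.\end{cases}$$
   Context: For an ideal $J$ of $R$ and an $R$-module $N$, the $i$-th local homology module of $N$ with respect to $J$ is $H^J_i(N)=\varprojlim_t \operatorname{Tor}^R_i(R/J^t,N)$. For ideals $I,J$, the $i$-th $I$-formal local homology module of an $R$-module $M$ with respect to $J$ is $\mathfrak{F}^I_{i,J}(M)=\varinjlim_t H^J_i(0:_M I^t)$, where $0:_M I^t=\{x\in M: I^t x=0\}$ and the transition maps are induced by the inclusions $0:_M I^t\subseteq 0:_M I^{t+1}$. $H^i_I(N)=\varinjlim_t\operatorname{Ext}^i_R(R/I^t,N)$ is the usual local cohomology. *)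

(* Defs.v *)
From HB Require Import structures.
From mathcomp Require Import all_boot all_algebra.
From mathcomp Require Import boolp functions.
From mathcomp Require Import freeg.

Set Implicit Arguments.
Unset Strict Implicit.
Unset Printing Implicit Defensive.

Import GRing.Theory.
Local Open Scope ring_scope.
Local Open Scope quotient_scope.

(* Submodules of an R-module V are the predicates of type [submodClosed V];
   in particular an ideal of R (possibly the unit ideal) is a term of type
   [submodClosed R^o].  The [idealr] structure of ring_quotient only covers
   proper ideals. *)

Section SubmodulePredicates.
Variables (R : comNzRingType) (V : lmodType R).

Definition full_pred : {pred V} := fun=> true.

Fact full_submod_closed : submod_closed full_pred.
Proof. by []. Qed.

HB.instance Definition _ :=
  GRing.isSubmodClosed.Build R V full_pred full_submod_closed.

Definition span (S : V -> Prop) : {pred V} := fun v =>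
  `[< forall P : submodClosed V, (forall x, S x -> x \in P) -> v \in P >].

Fact span_submod_closed S : submod_closed (span S).
Proof.
split=> [|a u v /asboolP Su /asboolP Sv].
  by apply/asboolP => P _; exact: rpred0.
by apply/asboolP => P SP; rewrite rpredD ?rpredZ ?Su ?Sv.
Qed.

HB.instance Definition _ S :=
  GRing.isSubmodClosed.Build R V (span S) (span_submod_closed S).

Lemma mem_span (S : V -> Prop) x : S x -> x \in span S.
Proof. by move=> Sx; apply/asboolP => P; exact. Qed.

Lemma span_min (S : V -> Prop) (P : submodClosed V) :
  (forall x, S x -> x \in P) -> {subset span S <= P}.
Proof. by move=> SP x /asboolP; exact. Qed.

End SubmodulePredicates.

Section KernelImage.
Variables (R : comNzRingType) (U V : lmodType R) (f : {linear U -> V}).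

Definition ker_pred : {pred U} := fun u => f u == 0.

Fact ker_submod_closed : submod_closed ker_pred.
Proof.
split=> [|a u v]; rewrite !unfold_in ?linear0 //.
by move=> /eqP fu /eqP fv; rewrite linearP fu fv scaler0 addr0.
Qed.

HB.instance Definition _ :=
  GRing.isSubmodClosed.Build R U ker_pred ker_submod_closed.

Definition im_pred : {pred V} := fun v => `[< exists u, f u = v >].

Fact im_submod_closed : submod_closed im_pred.
Proof.
split=> [|a _ _ /asboolP[u <-] /asboolP[v <-]]; apply/asboolP.
  by exists 0; exact: linear0.
by exists (a *: u + v); rewrite linearP.
Qed.

HB.instance Definition _ :=
  GRing.isSubmodClosed.Build R V im_pred im_submod_closed.

Definition preim_pred (P : submodClosed V) : {pred U} := fun u => f u \in P.

Fact preim_submod_closed P : submod_closed (preim_pred P).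
Proof.
split=> [|a u v Pu Pv]; rewrite unfold_in ?linear0 ?rpred0 //.
by rewrite linearP rpredD ?rpredZ.
Qed.

HB.instance Definition _ P :=
  GRing.isSubmodClosed.Build R U (preim_pred P) (preim_submod_closed P).

End KernelImage.

Section Submod.
Variables (R : comNzRingType) (V : lmodType R) (P : submodClosed V).

Record submod := Submod { submod_val : V; submod_valP : submod_val \in P }.

HB.instance Definition _ := [isSub for submod_val].
HB.instance Definition _ := [Choice of submod by <:].
HB.instance Definition _ := [SubChoice_isSubLmodule of submod by <:].

Fact submod_val_linear : linear submod_val.
Proof. by move=> a u v; exact: (linearP (val : {linear submod -> V})). Qed.

HB.instance Definition _ :=
  GRing.isLinear.Build R submod V *:%R submod_val submod_val_linear.

End Submod.

Section Quotmod.
Variables (R : comNzRingType) (V : lmodType R) (P : submodClosed V).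

(* [Quotient.quot] expects a [zmodClosed], which a [submodClosed] does not
   inherit from. *)
Definition zmod_pred : {pred V} := fun v => v \in P.

Fact zmod_pred_closed : zmod_closed zmod_pred.
Proof. exact: GRing.submod_closedB (submodClosedP P). Qed.

HB.instance Definition _ :=
  GRing.isZmodClosed.Build V zmod_pred zmod_pred_closed.

Definition quotmod := Quotient.quot zmod_pred.

HB.instance Definition _ := GRing.Zmodule.on quotmod.
HB.instance Definition _ := EqQuotient.on quotmod.

Definition quotmod_pi (v : V) : quotmod := \pi v.

Lemma quotmod_pi_eq u v : (quotmod_pi u == quotmod_pi v) = (u - v \in P).
Proof. by rewrite [RHS](Quotient.idealrBE zmod_pred). Qed.

Lemma quotmod_reprK (x : quotmod) : quotmod_pi (repr x) = x.
Proof. exact: reprK. Qed.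

Lemma quotmod_piD u v : quotmod_pi (u + v) = quotmod_pi u + quotmod_pi v.
Proof. exact: (raddfD (\pi_(Quotient.quot zmod_pred))). Qed.

Definition quotmod_scale a (x : quotmod) : quotmod :=
  quotmod_pi (a *: repr x).

Lemma quotmod_scale_pi a v :
  quotmod_scale a (quotmod_pi v) = quotmod_pi (a *: v).
Proof.
apply/eqP; rewrite quotmod_pi_eq -scalerBr rpredZ //.
by rewrite -quotmod_pi_eq quotmod_reprK.
Qed.

Fact quotmod_scaleA a b x :
  quotmod_scale a (quotmod_scale b x) = quotmod_scale (a * b) x.
Proof. by rewrite -[x]quotmod_reprK !quotmod_scale_pi scalerA. Qed.

Fact quotmod_scale1 : left_id 1 quotmod_scale.
Proof.
move=> x; rewrite -[x in LHS]quotmod_reprK quotmod_scale_pi scale1r.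
exact: quotmod_reprK.
Qed.

Fact quotmod_scaleDr : right_distributive quotmod_scale +%R.
Proof.
move=> a x y; rewrite -[x]quotmod_reprK -[y]quotmod_reprK.
by rewrite -quotmod_piD !quotmod_scale_pi scalerDr quotmod_piD.
Qed.

Fact quotmod_scaleDl x : {morph quotmod_scale^~ x : a b / a + b}.
Proof.
move=> a b; rewrite -[x]quotmod_reprK !quotmod_scale_pi.
by rewrite scalerDl quotmod_piD.
Qed.

HB.instance Definition _ := GRing.Zmodule_isLmodule.Build R quotmod
  quotmod_scaleA quotmod_scale1 quotmod_scaleDr quotmod_scaleDl.

Fact quotmod_pi_linear : linear quotmod_pi.
Proof. by move=> a u v; rewrite quotmod_piD -quotmod_scale_pi. Qed.

HB.instance Definition _ :=
  GRing.isLinear.Build R V quotmod *:%R quotmod_pi quotmod_pi_linear.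

End Quotmod.

Section InducedMaps.
Variables (R : comNzRingType) (U V : lmodType R).
Variables (P : submodClosed U) (Q : submodClosed V) (f : {linear U -> V}).
Hypothesis fPQ : forall u, u \in P -> f u \in Q.

Definition submod_map (x : submod P) : submod Q :=
  Submod (fPQ (submod_valP x)).

Fact submod_map_linear : linear submod_map.
Proof. by move=> a x y; apply: val_inj; rewrite /= !linearP. Qed.

HB.instance Definition _ :=
  GRing.isLinear.Build R (submod P) (submod Q) *:%R submod_map
    submod_map_linear.

#[using="fPQ"]
Definition quotmod_map (x : quotmod P) : quotmod Q := quotmod_pi Q (f (repr x)).

Lemma quotmod_map_pi u : quotmod_map (quotmod_pi P u) = quotmod_pi Q (f u).
Proof.
apply/eqP; rewrite quotmod_pi_eq -linearB fPQ //.
by rewrite -quotmod_pi_eq quotmod_reprK.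
Qed.

Fact quotmod_map_linear : linear quotmod_map.
Proof.
move=> a x y; rewrite -[x]quotmod_reprK -[y]quotmod_reprK -linearP.
by rewrite !quotmod_map_pi !linearP.
Qed.

HB.instance Definition _ :=
  GRing.isLinear.Build R (quotmod P) (quotmod Q) *:%R quotmod_map
    quotmod_map_linear.

End InducedMaps.

(* Homology at V of U --f--> V --g--> W, that is ker g / im f. *)
Section Homology.
Variables (R : comNzRingType) (U V W : lmodType R).
Variables (f : {linear U -> V}) (g : {linear V -> W}).

Definition cycles : lmodType R := submod (ker_pred g).

Definition boundaries : submodClosed cycles :=
  preim_pred (@submod_val R V (ker_pred g)) (im_pred f).

Definition homology : lmodType R := quotmod boundaries.

End Homology.

Section HomologyMap.
Variables (R : comNzRingType) (U V W U' V' W' : lmodType R).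
Variables (f : {linear U -> V}) (g : {linear V -> W}).
Variables (f' : {linear U' -> V'}) (g' : {linear V' -> W'}).
Variables (a : {linear U -> U'}) (b : {linear V -> V'}) (c : {linear W -> W'}).
Hypotheses (baf : b \o f =1 f' \o a) (cbg : c \o g =1 g' \o b).

Fact cycles_map_subproof v : v \in ker_pred g -> b v \in ker_pred g'.
Proof.
by rewrite !unfold_in => /eqP gv; have /= <- := cbg v; rewrite gv linear0.
Qed.

Definition cycles_map : {linear cycles g -> cycles g'} :=
  submod_map cycles_map_subproof.

Fact homology_map_subproof z :
  z \in boundaries f g -> cycles_map z \in boundaries f' g'.
Proof.
move=> /asboolP[u fu]; apply/asboolP; exists (a u).
by have /= <- := baf u; rewrite fu.
Qed.

Definition homology_map : {linear homology f g -> homology f' g'} :=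
  quotmod_map homology_map_subproof.

End HomologyMap.

Definition freemod (R : comNzRingType) (K : choiceType) : lmodType R :=
  {freeg K / R}.

Definition fbasis (R : comNzRingType) (K : choiceType) (k : K) : freemod R K :=
  << k >>.

Section FreeModule.
Variables (R : comNzRingType) (K : choiceType) (V : lmodType R) (f : K -> V).

Definition free_lift_fun (x : freemod R K) : V := fglift f x.

Fact free_lift_zmod_morphism : zmod_morphism free_lift_fun.
Proof. exact: lift_is_additive. Qed.

HB.instance Definition _ :=
  GRing.isZmodMorphism.Build (freemod R K) V free_lift_fun
    free_lift_zmod_morphism.

Fact free_lift_scalable : scalable free_lift_fun.
Proof.
move=> a x; have -> : free_lift_fun x = \sum_(k <- dom x) coeff k x *: f k.
  rewrite -[in LHS](freeg_sumE x) raddf_sum; apply: eq_bigr => k _.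
  exact: liftU.
have -> : a *: x = \sum_(k <- dom x) << a * coeff k x *g k >> by [].
rewrite raddf_sum scaler_sumr; apply: eq_bigr => k _.
by rewrite scalerA; exact: liftU.
Qed.

HB.instance Definition _ :=
  GRing.isScalable.Build R (freemod R K) V *:%R free_lift_fun
    free_lift_scalable.

Definition free_lift : {linear freemod R K -> V} := free_lift_fun.

Lemma free_lift_basis k : free_lift (fbasis R k) = f k.
Proof. by rewrite /= /free_lift_fun liftU scale1r. Qed.

End FreeModule.

Lemma freemod_ext (R : comNzRingType) (K : choiceType) (V : lmodType R)
    (f g : {linear freemod R K -> V}) :
  (forall k, f (fbasis R k) = g (fbasis R k)) -> f =1 g.
Proof.
move=> fg x.
have -> : x = \sum_(k <- dom x) coeff k x *: fbasis R k.
  rewrite -[LHS](freeg_sumE x); apply: eq_bigr => k _.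
  by apply/eqP/freeg_eqP => l; rewrite coeffZ !coeffU mul1r.
rewrite !linear_sum; apply: eq_bigr => k _.
by rewrite !linearZ fg.
Qed.

Definition zero_mod (R : comNzRingType) : lmodType R := 'rV[R]_0.

(* The canonical free resolution of A: writing F(X) for the free module on the
   underlying set of X, F_n = F(syz n A), where syz 0 A = A and syz n.+1 A is
   the kernel of the evaluation map F(syz n A) -> syz n A. *)
Section Resolution.
Variable R : comNzRingType.

Definition free (A : lmodType R) : lmodType R := freemod R A.

Definition free_eval (A : lmodType R) : {linear free A -> A} :=
  @free_lift R A A id.

Definition free_map (A B : lmodType R) (f : A -> B) :
    {linear free A -> free B} :=
  @free_lift R A (free B) (fun x => @fbasis R B (f x)).

Lemma free_eval_map (A B : lmodType R) (f : {linear A -> B}) x :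
  f (free_eval A x) = free_eval B (free_map f x).
Proof.
move: x; apply: (@freemod_ext R A B (f \o free_eval A)
  (free_eval B \o free_map f)) => k.
change (f (free_eval A (fbasis R k)) = free_eval B (free_map f (fbasis R k))).
by rewrite !free_lift_basis.
Qed.

Definition syz1 (A : lmodType R) : lmodType R :=
  submod (ker_pred (free_eval A)).

Fact syz1_map_subproof (A B : lmodType R) (f : {linear A -> B}) x :
  x \in ker_pred (free_eval A) -> free_map f x \in ker_pred (free_eval B).
Proof.
rewrite !unfold_in => /eqP ex0.
by rewrite -free_eval_map ex0 linear0.
Qed.

Definition syz1_map (A B : lmodType R) (f : {linear A -> B}) :
    {linear syz1 A -> syz1 B} :=
  submod_map (syz1_map_subproof f).

Definition syz n (A : lmodType R) : lmodType R := iter n syz1 A.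

Fixpoint syz_map n (A B : lmodType R) (f : {linear A -> B}) :
    {linear syz n A -> syz n B} :=
  if n is m.+1 then syz1_map (syz_map m f) else f.

Definition res n (A : lmodType R) : lmodType R := free (syz n A).

Definition res_map n (A B : lmodType R) (f : {linear A -> B}) :
    {linear res n A -> res n B} :=
  free_map (syz_map n f).

Section ResolutionSquare.
Variables (A B B' C : lmodType R).
Variables (f : {linear A -> B}) (g : {linear B -> C}).
Variables (f' : {linear A -> B'}) (g' : {linear B' -> C}).

Fact free_map_square :
  (forall x, g (f x) = g' (f' x)) ->
  forall x, free_map g (free_map f x) = free_map g' (free_map f' x).
Proof.
move=> gf; apply: (@freemod_ext R A (free C) (free_map g \o free_map f)
  (free_map g' \o free_map f')) => k.
change (free_map g (free_map f (fbasis R k)) =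
        free_map g' (free_map f' (fbasis R k))).
by rewrite !free_lift_basis gf.
Qed.

End ResolutionSquare.

Fact syz_map_square n (A B B' C : lmodType R)
    (f : {linear A -> B}) (g : {linear B -> C})
    (f' : {linear A -> B'}) (g' : {linear B' -> C}) :
  (forall x, g (f x) = g' (f' x)) ->
  forall x, syz_map n g (syz_map n f x) = syz_map n g' (syz_map n f' x).
Proof.
move=> gf; elim: n => [|n IH] x; first exact: gf.
by apply: val_inj; apply: (free_map_square IH).
Qed.

Fact res_map_square n (A B B' C : lmodType R)
    (f : {linear A -> B}) (g : {linear B -> C})
    (f' : {linear A -> B'}) (g' : {linear B' -> C}) :
  (forall x, g (f x) = g' (f' x)) ->
  forall x, res_map n g (res_map n f x) = res_map n g' (res_map n f' x).
Proof. by move=> gf; apply/free_map_square/syz_map_square. Qed.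

(* [res_prev n] is F_(n-1), with F_(-1) = 0, and [res_d n] is the differential
   F_n -> F_(n-1). *)
Definition res_prev n (A : lmodType R) : lmodType R :=
  if n is m.+1 then res m A else zero_mod R.

Definition res_prev_map n (A B : lmodType R) (f : {linear A -> B}) :
    {linear res_prev n A -> res_prev n B} :=
  if n is m.+1 then res_map m f else idfun.

Definition res_d n (A : lmodType R) : {linear res n A -> res_prev n A} :=
  if n is m.+1 then
    @submod_val R _ (ker_pred (free_eval (syz m A))) \o free_eval (syz m.+1 A)
  else \0.

Lemma res_d_map n (A B : lmodType R) (f : {linear A -> B}) :
  res_prev_map n f \o @res_d n A =1 @res_d n B \o res_map n f.
Proof.
case: n => [|n] x; first by [].
by rewrite /= -(free_eval_map (syz_map n.+1 f)).
Qed.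

Lemma res_augmentation_surjective (A : lmodType R) (x : A) :
  exists y : res 0 A, free_eval A y = x.
Proof. by exists (fbasis R x); exact: free_lift_basis. Qed.

Lemma syz_exact n (A : lmodType R) (x : res n A) :
  free_eval (syz n A) x = 0 <-> exists y, res_d n.+1 A y = x.
Proof.
split=> [x0|[y <-]]; last by apply/eqP; exact: (submod_valP (free_eval _ y)).
have x_ker : x \in ker_pred (free_eval (syz n A)) by rewrite unfold_in x0.
exists (@fbasis R (syz n.+1 A) (Submod x_ker)).
exact: (congr1 (@submod_val _ _ _) (free_lift_basis _ _)).
Qed.

Lemma res_exact n (A : lmodType R) (x : res n.+1 A) :
  res_d n.+1 A x = 0 <-> exists y, res_d n.+2 A y = x.
Proof.
rewrite -syz_exact; split=> [x0|/= ->]; last exact: linear0.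
by apply: val_inj; exact: x0.
Qed.

End Resolution.

Section Tensor.
Variables (R : comNzRingType) (A B : lmodType R).

Local Notation e a b := (@fbasis R (A * B)%type (a, b)).

Inductive tensor_rel : freemod R (A * B)%type -> Prop :=
| tensor_relDl a a' b :
    tensor_rel (e (a + a') b - e a b - e a' b)
| tensor_relDr a b b' :
    tensor_rel (e a (b + b') - e a b - e a b')
| tensor_relZl r a b :
    tensor_rel (e (r *: a) b - r *: e a b)
| tensor_relZr r a b :
    tensor_rel (e a (r *: b) - r *: e a b).

Definition tensor : lmodType R := quotmod (span tensor_rel).

Definition tens (a : A) (b : B) : tensor :=
  quotmod_pi (span tensor_rel) (e a b).

End Tensor.

Lemma tensor_ext (R : comNzRingType) (A B V : lmodType R)
    (f g : {linear tensor A B -> V}) :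
  (forall a b, f (tens a b) = g (tens a b)) -> f =1 g.
Proof.
move=> fg x; rewrite -[x]quotmod_reprK; move: (repr x).
apply: (@freemod_ext R (A * B)%type V
  (f \o @quotmod_pi _ _ (span (@tensor_rel R A B)))
  (g \o @quotmod_pi _ _ (span (@tensor_rel R A B)))) => -[a b].
exact: fg.
Qed.

Section TensorMap.
Variables (R : comNzRingType) (A B A' B' : lmodType R).
Variables (f : {linear A -> A'}) (g : {linear B -> B'}).

Definition tensor_map_free :
    {linear freemod R (A * B)%type -> freemod R (A' * B')%type} :=
  @free_lift R (A * B)%type (freemod R (A' * B')%type)
    (fun p => @fbasis R (A' * B')%type (f p.1, g p.2)).

Fact tensor_map_subproof x :
  x \in span (@tensor_rel R A B) ->
  tensor_map_free x \in span (@tensor_rel R A' B').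
Proof.
move: x; apply: (@span_min _ _ _ (preim_pred tensor_map_free _)) => x tx.
rewrite unfold_in; apply: mem_span.
have tE a b : tensor_map_free (@fbasis R (A * B)%type (a, b)) =
    @fbasis R (A' * B')%type (f a, g b) by exact: free_lift_basis.
case: tx => [a a' b|a b b'|r a b|r a b].
- rewrite !linearB !tE linearD; exact: tensor_relDl.
- rewrite !linearB !tE linearD; exact: tensor_relDr.
- rewrite linearB linearZ !tE linearZ; exact: tensor_relZl.
- rewrite linearB linearZ !tE linearZ; exact: tensor_relZr.
Qed.

Definition tensor_map : {linear tensor A B -> tensor A' B'} :=
  quotmod_map tensor_map_subproof.

Lemma tensor_map_tens a b : tensor_map (tens a b) = tens (f a) (g b).
Proof.
rewrite [LHS](quotmod_map_pi tensor_map_subproof); congr quotmod_pi.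
exact: free_lift_basis.
Qed.

End TensorMap.

Section HomModule.
Variables (R : comNzRingType).

Definition linear_pred (U V : lmodType R) : {pred U -> V} :=
  fun f => `[< linear f >].

Fact linear_submod_closed (U V : lmodType R) :
  submod_closed (@linear_pred U V).
Proof.
split=> [|r f g /asboolP fL /asboolP gL]; apply/asboolP => a u v.
  by rewrite scaler0 addr0.
rewrite /= ![(_ + _) _]/GRing.add /= ![(_ *: _) _]/GRing.scale /= fL gL.
rewrite !scalerDr !scalerA [r * a]mulrC -!addrA; congr (_ + _).
exact: addrCA.
Qed.

HB.instance Definition _ (U V : lmodType R) :=
  GRing.isSubmodClosed.Build R (U -> V) (@linear_pred U V)
    (@linear_submod_closed U V).

Definition hom (U V : lmodType R) : lmodType R := submod (@linear_pred U V).

Section Precomposition.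
Variables (U U' V : lmodType R) (f : {linear U' -> U}).

Fact hom_map_subproof (h : hom U V) :
  submod_val h \o f \in @linear_pred U' V.
Proof.
apply/asboolP => a u v /=; rewrite linearP.
by have /asboolP := submod_valP h; apply.
Qed.

Definition hom_map_fun (h : hom U V) : hom U' V :=
  Submod (hom_map_subproof h).

Fact hom_map_linear : linear hom_map_fun.
Proof. by move=> a h k; apply: val_inj. Qed.

HB.instance Definition _ :=
  GRing.isLinear.Build R (hom U V) (hom U' V) *:%R hom_map_fun hom_map_linear.

Definition hom_map : {linear hom U V -> hom U' V} := hom_map_fun.

End Precomposition.

End HomModule.

Section TorExt.
Variable R : comNzRingType.

Definition tor_nat n (A B : lmodType R) : lmodType R :=
  homology (tensor_map (res_d n.+1 A) (idfun : {linear B -> B}))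
           (tensor_map (res_d n A) (idfun : {linear B -> B})).

Fact tensor_res_d_map n (A A' B B' : lmodType R)
    (f : {linear A -> A'}) (g : {linear B -> B'}) :
  tensor_map (res_prev_map n f) g \o
      tensor_map (res_d n A) (idfun : {linear B -> B}) =1
  tensor_map (res_d n A') (idfun : {linear B' -> B'}) \o
      tensor_map (res_map n f) g.
Proof.
apply: (@tensor_ext _ _ _ _ (tensor_map (res_prev_map n f) g \o
      tensor_map (res_d n A) (idfun : {linear B -> B}))
  (tensor_map (res_d n A') (idfun : {linear B' -> B'}) \o
      tensor_map (res_map n f) g)) => a b.
rewrite /= !tensor_map_tens; congr tens; exact: res_d_map.
Qed.

Definition tor_nat_map n (A A' B B' : lmodType R)
    (f : {linear A -> A'}) (g : {linear B -> B'}) :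
    {linear tor_nat n A B -> tor_nat n A' B'} :=
  homology_map (@tensor_res_d_map n.+1 A A' B B' f g)
               (@tensor_res_d_map n A A' B B' f g).

Definition tor (i : int) (A B : lmodType R) : lmodType R :=
  if i is Posz n then tor_nat n A B else zero_mod R.

Definition tor_map (i : int) (A A' B B' : lmodType R)
    (f : {linear A -> A'}) (g : {linear B -> B'}) :
    {linear tor i A B -> tor i A' B'} :=
  if i is Posz n then tor_nat_map n f g else idfun.

Fact tor_map_square i (A A' B B' : lmodType R)
    (f : {linear A -> A'}) (g : {linear B -> B'}) x :
  tor_map i f (idfun : {linear B' -> B'})
    (tor_map i (idfun : {linear A -> A}) g x) =
  tor_map i (idfun : {linear A' -> A'}) g
    (tor_map i f (idfun : {linear B -> B}) x).
Proof.
case: i x => [n|//] x.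
have sq y : tensor_map (res_map n f) (idfun : {linear B' -> B'})
      (tensor_map (res_map n (idfun : {linear A -> A})) g y) =
    tensor_map (res_map n (idfun : {linear A' -> A'})) g
      (tensor_map (res_map n f) (idfun : {linear B -> B}) y).
  move: y; apply: (@tensor_ext _ _ _ _
    (tensor_map (res_map n f) (idfun : {linear B' -> B'}) \o
       tensor_map (res_map n (idfun : {linear A -> A})) g)
    (tensor_map (res_map n (idfun : {linear A' -> A'})) g \o
       tensor_map (res_map n f) (idfun : {linear B -> B}))) => a b.
  rewrite /= !tensor_map_tens; congr tens.
  exact: res_map_square.
rewrite -[x]quotmod_reprK; move: (repr x) => z.
rewrite /tor_map /tor_nat_map /homology_map /= !quotmod_map_pi.
by congr quotmod_pi; apply: val_inj; exact: sq.
Qed.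

Definition ext_nat n (A B : lmodType R) : lmodType R :=
  homology (hom_map B (res_d n A)) (hom_map B (res_d n.+1 A)).

Fact hom_res_d_map n (A A' B : lmodType R) (f : {linear A -> A'}) :
  hom_map B (res_map n f) \o hom_map B (res_d n A') =1
  hom_map B (res_d n A) \o hom_map B (res_prev_map n f).
Proof.
move=> h; apply: val_inj; apply: funext => x /=.
by congr (submod_val h); have /= -> := res_d_map f x.
Qed.

Definition ext_nat_map n (A A' B : lmodType R) (f : {linear A -> A'}) :
    {linear ext_nat n A' B -> ext_nat n A B} :=
  homology_map (@hom_res_d_map n A A' B f) (@hom_res_d_map n.+1 A A' B f).

Definition ext (i : int) (A B : lmodType R) : lmodType R :=
  if i is Posz n then ext_nat n A B else zero_mod R.

Definition ext_map (i : int) (A A' B : lmodType R) (f : {linear A -> A'}) :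
    {linear ext i A' B -> ext i A B} :=
  if i is Posz n then ext_nat_map n B f else idfun.

End TorExt.

Section Product.
Variables (R : comNzRingType) (M : nat -> lmodType R).

Definition prodmod := forall n, M n.

HB.instance Definition _ := Choice.on prodmod.

Definition prodmod_add (x y : prodmod) : prodmod := fun n => x n + y n.
Definition prodmod_opp (x : prodmod) : prodmod := fun n => - x n.
Definition prodmod_scale a (x : prodmod) : prodmod := fun n => a *: x n.

Fact prodmod_addA : associative prodmod_add.
Proof. by move=> x y z; apply: functional_extensionality_dep => n; exact: addrA. Qed.

Fact prodmod_addC : commutative prodmod_add.
Proof. by move=> x y; apply: functional_extensionality_dep => n; exact: addrC. Qed.

Fact prodmod_add0 : left_id ((fun n => 0) : prodmod) prodmod_add.
Proof. by move=> x; apply: functional_extensionality_dep => n; exact: add0r. Qed.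

Fact prodmod_addN :
  left_inverse ((fun n => 0) : prodmod) prodmod_opp prodmod_add.
Proof. by move=> x; apply: functional_extensionality_dep => n; exact: addNr. Qed.

HB.instance Definition _ := GRing.isZmodule.Build prodmod
  prodmod_addA prodmod_addC prodmod_add0 prodmod_addN.

Fact prodmod_scaleA a b x :
  prodmod_scale a (prodmod_scale b x) = prodmod_scale (a * b) x.
Proof. by apply: functional_extensionality_dep => n; exact: scalerA. Qed.

Fact prodmod_scale1 : left_id 1 prodmod_scale.
Proof. by move=> x; apply: functional_extensionality_dep => n; exact: scale1r. Qed.

Fact prodmod_scaleDr : right_distributive prodmod_scale +%R.
Proof.
by move=> a x y; apply: functional_extensionality_dep => n; exact: scalerDr.
Qed.

Fact prodmod_scaleDl x : {morph prodmod_scale^~ x : a b / a + b}.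
Proof.
by move=> a b; apply: functional_extensionality_dep => n; exact: scalerDl.
Qed.

HB.instance Definition _ := GRing.Zmodule_isLmodule.Build R prodmod
  prodmod_scaleA prodmod_scale1 prodmod_scaleDr prodmod_scaleDl.

End Product.

Section InverseLimit.
Variables (R : comNzRingType) (M : nat -> lmodType R).
Variable p : forall n, {linear M n.+1 -> M n}.

Definition compatible_pred : {pred prodmod M} :=
  fun x => `[< forall n, p n (x n.+1) = x n >].

Fact compatible_submod_closed : submod_closed compatible_pred.
Proof.
split=> [|a x y /asboolP px /asboolP py]; apply/asboolP => n.
  exact: linear0.
by have := linearP (p n) a (x n.+1) (y n.+1); rewrite px py.
Qed.

HB.instance Definition _ :=
  GRing.isSubmodClosed.Build R (prodmod M) compatible_pred
    compatible_submod_closed.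

Definition invlim : lmodType R := submod compatible_pred.

End InverseLimit.

Section InverseLimitMap.
Variables (R : comNzRingType) (M M' : nat -> lmodType R).
Variables (p : forall n, {linear M n.+1 -> M n}).
Variables (p' : forall n, {linear M' n.+1 -> M' n}).
Variable f : forall n, {linear M n -> M' n}.
Hypothesis pf : forall n, f n \o p n =1 p' n \o f n.+1.

Definition prodmod_map (x : prodmod M) : prodmod M' := fun n => f n (x n).

Fact prodmod_map_linear : linear prodmod_map.
Proof.
move=> a x y; apply: functional_extensionality_dep => n.
exact: (linearP (f n)).
Qed.

HB.instance Definition _ :=
  GRing.isLinear.Build R (prodmod M) (prodmod M') *:%R prodmod_map
    prodmod_map_linear.

Fact invlim_map_subproof x :
  x \in compatible_pred p -> prodmod_map x \in compatible_pred p'.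
Proof.
move=> /asboolP px; apply/asboolP => n.
by have /= <- := @pf n (x n.+1); rewrite px.
Qed.

Definition invlim_map : {linear invlim p -> invlim p'} :=
  submod_map invlim_map_subproof.

End InverseLimitMap.

(* The direct limit of M 0 -> M 1 -> ..., as the quotient of the direct sum by
   the submodule generated by the x - q n x, with x in M n and q n x in
   M n.+1. *)
Section DirectLimit.
Variables (R : comNzRingType) (M : nat -> lmodType R).
Variable q : forall n, {linear M n -> M n.+1}.

Definition finsupp_pred : {pred prodmod M} :=
  fun x => `[< exists N, forall n, (N <= n)%N -> x n = 0 >].

Fact finsupp_submod_closed : submod_closed finsupp_pred.
Proof.
split=> [|a x y /asboolP[k xk] /asboolP[l yl]]; apply/asboolP.
  by exists 0%N.
exists (maxn k l) => n; rewrite geq_max => /andP[kn ln].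
have -> : (a *: x + y) n = a *: x n + y n by [].
by rewrite xk // yl // scaler0 addr0.
Qed.

HB.instance Definition _ :=
  GRing.isSubmodClosed.Build R (prodmod M) finsupp_pred finsupp_submod_closed.

Definition dirsum : lmodType R := submod finsupp_pred.

Definition prod_in n (x : M n) : prodmod M :=
  dfwith ((fun=> 0) : forall k, M k) x.

Fact dirsum_in_subproof n (x : M n) : prod_in x \in finsupp_pred.
Proof.
apply/asboolP; exists n.+1 => k nk; rewrite /prod_in dfwith_out //.
by rewrite ltn_eqF.
Qed.

Definition dirsum_in n (x : M n) : dirsum := Submod (dirsum_in_subproof x).

Definition dirlim_rel (z : dirsum) : Prop :=
  exists n (x : M n), z = dirsum_in x - dirsum_in (q n x).

Definition dirlim : lmodType R := quotmod (span dirlim_rel).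

Definition dirlim_in n (x : M n) : dirlim :=
  quotmod_pi (span dirlim_rel) (dirsum_in x).

End DirectLimit.

Section Ideals.
Variable R : comNzRingType.
Implicit Types I J K : submodClosed R^o.

Fixpoint ideal_exp I n : submodClosed R^o :=
  if n is m.+1 then
    span (fun x : R^o => exists a b : R,
      [/\ a \in ideal_exp I m, b \in I & x = a * b])
  else @full_pred R R^o.

Lemma ideal_exp_sub I n : {subset ideal_exp I n.+1 <= ideal_exp I n}.
Proof.
apply: span_min => _ [a [b [aI bI ->]]].
by rewrite mulrC; exact: (rpredZ b).
Qed.

Definition quot_exp I n : lmodType R := quotmod (ideal_exp I n).

Fact quot_exp_map_subproof I n (x : R^o) :
  x \in ideal_exp I n.+1 -> (idfun : {linear R^o -> R^o}) x \in ideal_exp I n.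
Proof. exact: ideal_exp_sub. Qed.

Definition quot_exp_map I n : {linear quot_exp I n.+1 -> quot_exp I n} :=
  quotmod_map (@quot_exp_map_subproof I n).

Definition noetherian : Prop :=
  forall I, exists s : seq R^o, I =i span (fun x => x \in s).

Definition maximal_ideal I : Prop :=
  (1 : R) \notin I /\
  forall K, (1 : R) \notin K -> {subset I <= K} -> {subset K <= I}.

Definition local_ring (m : submodClosed R^o) : Prop :=
  maximal_ideal m /\ forall K, maximal_ideal K -> K =i m.

End Ideals.

Section Annihilated.
Variables (R : comNzRingType) (I : submodClosed R^o) (M : lmodType R).

Definition annihilated_pred n : {pred M} :=
  fun x => `[< forall a : R, a \in ideal_exp I n -> a *: x = 0 >].

Fact annihilated_submod_closed n : submod_closed (annihilated_pred n).
Proof.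
split=> [|a x y /asboolP Ix /asboolP Iy]; apply/asboolP => b Ib.
  exact: scaler0.
by rewrite scalerDr scalerA mulrC -scalerA Ix // Iy // scaler0 addr0.
Qed.

HB.instance Definition _ n :=
  GRing.isSubmodClosed.Build R M (annihilated_pred n)
    (annihilated_submod_closed n).

Definition annihilated n : lmodType R := submod (annihilated_pred n).

Fact annihilated_incl_subproof n x :
  x \in annihilated_pred n ->
  (idfun : {linear M -> M}) x \in annihilated_pred n.+1.
Proof.
move=> /asboolP Ix; apply/asboolP => a Ia.
by apply: Ix; exact: ideal_exp_sub Ia.
Qed.

Definition annihilated_incl n : {linear annihilated n -> annihilated n.+1} :=
  submod_map (@annihilated_incl_subproof n).

End Annihilated.

Section LocalHomologyCohomology.
Variable R : comNzRingType.
Implicit Types (I J : submodClosed R^o) (N : lmodType R) (i : int).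

Definition local_homology J i N : lmodType R :=
  invlim (fun t => tor_map i (quot_exp_map J t) (idfun : {linear N -> N})).

Fact local_homology_map_subproof J i N N' (f : {linear N -> N'}) t :
  tor_map i (idfun : {linear quot_exp J t -> quot_exp J t}) f \o
    tor_map i (quot_exp_map J t) (idfun : {linear N -> N}) =1
  tor_map i (quot_exp_map J t) (idfun : {linear N' -> N'}) \o
    tor_map i (idfun : {linear quot_exp J t.+1 -> quot_exp J t.+1}) f.
Proof. by move=> x; rewrite /= tor_map_square. Qed.

Definition local_homology_map J i N N' (f : {linear N -> N'}) :
    {linear local_homology J i N -> local_homology J i N'} :=
  invlim_map (@local_homology_map_subproof J i N N' f).

Definition local_cohomology I i N : lmodType R :=
  dirlim (fun t => ext_map i N (quot_exp_map I t)).

Definition formal_local_homology I J i (M : lmodType R) : lmodType R :=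
  dirlim (fun t => local_homology_map J i (annihilated_incl I M t)).

End LocalHomologyCohomology.

Definition lmod_isomorphic (R : comNzRingType) (U V : lmodType R) : Prop :=
  exists f : {linear U -> V}, bijective f.

(* Main.v *)
(* The module F = F^I_{j,J}(M) is I-torsion, being a direct limit of modules
   killed by powers of I; so it suffices to compute the local cohomology of an
   I-torsion module N.  In degree 0 one has Ext^0(R/I^t, N) = 0 :_N I^t, whose
   union is N.  For n > 0 a class in Ext^n(R/I^t, N) is represented by a map
   h : syz^n(R/I^t) -> N modulo the maps that extend to the ambient free module.
   By induction on n there are a finitely generated K and a map
   u : K -> syz^n(R/I^t) such that, for every submodule L of K open for the
   I-adic topology, syz^n(R/I^s) -> syz^n(R/I^t) factors for large s as
   syz^n(R/I^s) -> L -> syz^n(R/I^t), up to a map that extends to the ambient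
   free module; the inductive step is the Artin-Rees lemma.  Taking
   L = ker (h u), which is open because K is finitely generated and N is
   torsion, kills the class of h at the stage s. *)

Require Import Defs.
From HB Require Import structures.
From mathcomp Require Import all_boot all_algebra.
From mathcomp Require Import boolp functions.
(* [vector] also exports a [span]; this makes the one of [Defs] prevail. *)
Import Defs.

Set Implicit Arguments.
Unset Strict Implicit.
Unset Printing Implicit Defensive.

Import GRing.Theory.
Local Open Scope ring_scope.

(** * Packing linear maps and submodules *)

Section LinearMaps.
Variable R : comNzRingType.

Definition mk_linear (U V : lmodType R) (f : U -> V) (fL : linear f) :
    {linear U -> V} :=
  HB.pack f (GRing.isLinear.Build R U V *:%R f fL).

Fact corestrict_linear (U V : lmodType R) (P : submodClosed V)
    (f : {linear U -> V}) (fP : forall u, f u \in P) :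
  linear (fun u => Submod (fP u)).
Proof. by move=> a u v; apply: val_inj; rewrite /= linearP. Qed.

Definition corestrict (U V : lmodType R) (P : submodClosed V)
    (f : {linear U -> V}) (fP : forall u, f u \in P) : {linear U -> submod P} :=
  mk_linear (corestrict_linear fP).

(** Inductions over [span] go through [span_min], which wants the induction predicate packed as a
    submodule. *)
Definition mk_submod (V : lmodType R) (P : {pred V}) (cl : submod_closed P) :
    submodClosed V :=
  HB.pack P (GRing.isSubmodClosed.Build R V P cl).

Lemma submod_predB (V : lmodType R) (P : submodClosed V) u v :
  u \in P -> v \in P -> u - v \in P.
Proof. by move=> uP vP; rewrite -scaleN1r rpredD ?rpredZ. Qed.

Lemma bijective_of_ker0 (U V : lmodType R) (f : {linear U -> V}) :
  (forall u, f u = 0 -> u = 0) -> (forall v, exists u, f u = v) -> bijective f.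
Proof.
move=> f0 /choice[g gK]; exists g => // u.
by apply/eqP; rewrite -subr_eq0; apply/eqP/f0; rewrite linearB gK subrr.
Qed.

End LinearMaps.

(** * Noetherian modules: finite generation and chain conditions *)

Section FiniteGeneration.
Variable R : comNzRingType.
Implicit Types V : lmodType R.

Definition fg_by V (P : {pred V}) (s : seq V) : Prop :=
  P =i span (fun x => x \in s).

Definition noetherian_mod V : Prop :=
  forall P : submodClosed V, exists s, fg_by P s.

Lemma span_mono V (S T : V -> Prop) :
  (forall x, S x -> T x) -> {subset span S <= span T}.
Proof. by move=> ST; apply: span_min => x /ST; exact: mem_span. Qed.

Lemma fg_sub V (P : submodClosed V) (s : seq V) :
  {subset P <= span (fun x => x \in s)} -> (forall x, x \in s -> x \in P) ->
  fg_by P s.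
Proof.
by move=> Ps sP x; apply/idP/idP; [exact: Ps | exact: (span_min sP)].
Qed.

Fact cons_decomp_closed V (x : V) (s : seq V) : submod_closed
  (fun v : V => `[< exists a : R, v - a *: x \in span (fun y => y \in s) >]).
Proof.
split=> [|c u v /asboolP[a ua] /asboolP[b vb]]; apply/asboolP.
  by exists 0; rewrite scale0r subr0 rpred0.
exists (c * a + b).
rewrite scalerDl -scalerA opprD addrACA -scalerBr.
by rewrite rpredD ?rpredZ.
Qed.

Lemma span_consP V (x : V) (s : seq V) v :
  v \in span (fun y => y \in x :: s) ->
  exists a : R, v - a *: x \in span (fun y => y \in s).
Proof.
pose D := mk_submod (cons_decomp_closed x s).
move=> vs; apply/asboolP; move: v vs; apply: (@span_min R V _ D) => y.
rewrite inE => /predU1P[->|ys]; apply/asboolP.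
  by exists 1; rewrite scale1r subrr rpred0.
by exists 0; rewrite scale0r subr0 mem_span.
Qed.

Fact lead_coef_closed V (P : submodClosed V) (x : V) (s : seq V) :
  submod_closed (fun a : R^o => `[< exists y,
    y \in span (fun y => y \in s) /\ a *: x + y \in P >]).
Proof.
split=> [|c a b /asboolP[y [ys yP]] /asboolP[z [zs zP]]]; apply/asboolP.
  by exists 0; rewrite scale0r addr0 !rpred0.
exists (c *: y + z); split; first by rewrite rpredD ?rpredZ.
have -> : (c *: a + b) *: x + (c *: y + z) = c *: (a *: x + y) + (b *: x + z).
  by rewrite scalerDl scalerDr -scalerA addrACA.
by rewrite rpredD ?rpredZ.
Qed.

Fact meet_closed V (P Q : submodClosed V) :
  submod_closed (fun v : V => (v \in P) && (v \in Q)).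
Proof.
split=> [|c u v /andP[uP uQ] /andP[vP vQ]]; apply/andP.
  by rewrite !rpred0.
by rewrite !rpredD ?rpredZ.
Qed.

(* The coefficients of [x] in the elements of [P] form an ideal; the elements
   with coefficient [0] lie in [span s], where the induction applies. *)
Lemma noetherian_sub_span V (s : seq V) (P : submodClosed V) :
  noetherian R -> {subset P <= span (fun x => x \in s)} -> exists t, fg_by P t.
Proof.
move=> nR; elim: s P => [|x s IH] P Ps.
  by exists [::]; apply: fg_sub.
pose C := mk_submod (lead_coef_closed P x s).
pose Q := mk_submod (meet_closed P (span (fun y => y \in s))).
have [t tQ] : exists t, fg_by Q t by apply: IH => v /andP[].
have [l lC] := nR C.
(* For [a] in [C], [f a] is an element of [P] with coefficient [a] at [x]; outside [C] nothing is
   required of it. *)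
have /choice[f fP] : forall a : R, exists fa : V, a \in C ->
    fa - a *: x \in span (fun y => y \in s) /\ fa \in P.
  move=> a; case: (boolP (a \in C)) => [/asboolP[y [ys yP]]|_].
    by exists (a *: x + y); rewrite addrAC subrr add0r.
  by exists 0.
exists ([seq f a | a <- l] ++ t); apply: fg_sub => v; last first.
  rewrite mem_cat => /orP[/mapP[a al ->]|vt].
    have : a \in C by rewrite lC mem_span.
    by move/fP => [].
  have : v \in Q by rewrite tQ mem_span.
  by case/andP.
move=> vP; have [a va] := span_consP (Ps _ vP).
have aC : a \in C.
  apply/asboolP; exists (v - a *: x); split=> //.
  by rewrite [X in X \in _](addrC (a *: x)) subrK.
pose X : submodClosed V := span (fun y => y \in [seq f a | a <- l] ++ t).
have [w [wX [wP wa]]] : exists w, w \in X /\ w \in P /\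
    w - a *: x \in span (fun y => y \in s).
  (* The set of coefficients realised by such a [w] is an ideal; it contains the generators [l] of
     [C], hence [a]. *)
  have cl : submod_closed (fun a : R^o => `[< exists w, w \in X /\ w \in P /\
    w - (a : R) *: x \in span (fun y => y \in s) >]).
    split=> [|c a1 a2 /asboolP[w1 [? [? W1]]] /asboolP[w2 [? [? W2]]]];
      apply/asboolP.
      by exists 0; rewrite scale0r subr0 !rpred0.
    exists (c *: w1 + w2); split; [|split]; do ?by rewrite rpredD ?rpredZ.
    have -> : c *: w1 + w2 - (c * a1 + a2) *: x =
        c *: (w1 - a1 *: x) + (w2 - a2 *: x).
      by rewrite scalerDl -scalerA opprD addrACA -scalerBr.
    by rewrite rpredD ?rpredZ.
  pose Y := mk_submod cl.
  have : a \in Y.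
    move: aC; rewrite lC; move: a {va}; apply: (@span_min _ _ _ Y) => b bl.
    have bC : b \in C by rewrite lC mem_span.
    have [? ?] := fP b bC; apply/asboolP; exists (f b); split=> //.
    by apply: mem_span; rewrite mem_cat map_f.
  by move/asboolP.
have vwQ : v - w \in Q.
  apply/andP; split; first exact: submod_predB.
  have -> : v - w = (v - a *: x) - (w - a *: x) by rewrite opprB addrA subrK.
  exact: submod_predB.
rewrite -[v](subrK w) rpredD //.
move: vwQ; rewrite tQ; apply: span_mono => y yt.
by rewrite mem_cat yt orbT.
Qed.

Definition fingen V : Prop :=
  exists s : seq V, forall v, v \in span (fun x => x \in s).

Lemma fingen_noetherian V : noetherian R -> fingen V -> noetherian_mod V.
Proof.
by move=> nR [s Vs] P; apply: (noetherian_sub_span nR) => v _; apply: Vs.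
Qed.

Lemma fingen_submod V (P : submodClosed V) s :
  fg_by P s -> fingen (submod P).
Proof.
move=> sP.
have sPP x : x \in s -> x \in P by move=> xs; rewrite sP mem_span.
pose t : seq (submod P) := pmap insub s; exists t => v.
have cl : submod_closed (fun x : V =>
    `[< exists2 w : submod P, w \in span (fun y => y \in t)
          & submod_val w = x >]).
  split=> [|a x y /asboolP[w wt <-] /asboolP[z zt <-]]; apply/asboolP.
    by exists 0; rewrite ?rpred0 // linear0.
  by exists (a *: w + z); rewrite ?linearP // rpredD ?rpredZ.
have : submod_val v \in mk_submod cl.
  have := submod_valP v; rewrite sP; move: (submod_val v).
  apply: (@span_min _ _ _ (mk_submod cl)) => x xs; apply/asboolP.
  exists (Submod (sPP x xs)) => //; apply: mem_span.
  rewrite mem_pmap; apply/mapP; exists x => //.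
  by rewrite (insubT (fun x => x \in P) (sPP x xs)).
by move/asboolP=> [w wt] /(@val_inj _ _ (submod P)) <-.
Qed.

(** The union of the chain is a submodule, and its finitely many generators already lie in one
    term. *)
Lemma noetherian_acc V (c : nat -> submodClosed V) : noetherian_mod V ->
  (forall n, {subset c n <= c n.+1}) -> exists N, forall n, {subset c n <= c N}.
Proof.
move=> nV cS.
have cle m n : (m <= n)%N -> {subset c m <= c n}.
  by move=> /subnK <-; elim: (n - m)%N => // k IH x /IH; exact: cS.
have cl : submod_closed (fun v : V => `[< exists n, v \in c n >]).
  split=> [|a u v /asboolP[k uk] /asboolP[l vl]]; apply/asboolP.
    by exists 0%N; rewrite rpred0.
  exists (maxn k l); rewrite rpredD ?rpredZ //.
    exact: cle (leq_maxl _ _) _ uk.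
  exact: cle (leq_maxr _ _) _ vl.
have [s sU] := nV (mk_submod cl).
suff [N sN] : exists N, forall x, x \in s -> x \in c N.
  exists N => n v vn; apply: (span_min sN); rewrite -sU.
  by apply/asboolP; exists n.
have : forall x, x \in s -> exists n, x \in c n.
  move=> x xs; have : x \in mk_submod cl by rewrite sU mem_span.
  by move/asboolP.
elim: s {sU} => [|x s IH] sc; first by exists 0%N.
have [n xn] := sc x (mem_head _ _).
have [N sN] := IH (fun y ys => sc y (mem_behead (s := x :: s) ys)).
exists (maxn n N) => y; rewrite inE => /predU1P[->|/sN].
  exact: cle (leq_maxl _ _) _ xn.
exact: cle (leq_maxr _ _) _.
Qed.

(** Without a maximal element, choice would produce a strictly increasing chain starting at [Q0]. *)
Lemma noetherian_maximal V (Phi : submodClosed V -> Prop)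
    (Q0 : submodClosed V) :
  noetherian_mod V -> Phi Q0 ->
  exists2 Q, Phi Q &
    forall Q', Phi Q' -> {subset Q <= Q'} -> {subset Q' <= Q}.
Proof.
move=> nV Phi0; apply: contrapT => noMax.
have /choice[next nextP] : forall Q : {Q | Phi Q}, exists Q' : {Q | Phi Q},
    {subset sval Q <= sval Q'} /\ ~ {subset sval Q' <= sval Q}.
  move=> [Q PhiQ]; apply: contrapT => noNext; apply: noMax; exists Q => //.
  move=> Q' PhiQ' QQ'; apply: contrapT => nQ'Q; apply: noNext.
  by exists (exist _ Q' PhiQ').
pose c n := sval (iter n next (exist _ Q0 Phi0)).
have [N cN] : exists N, forall n, {subset c n <= c N}.
  apply: noetherian_acc => // n.
  by have [] := nextP (iter n next (exist _ Q0 Phi0)).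
have [_] := nextP (iter N next (exist _ Q0 Phi0)); apply; exact: cN N.+1.
Qed.

End FiniteGeneration.

(** * Powers of an ideal and a form of the Artin-Rees lemma *)

Section IdealPowers.
Variables (R : comNzRingType) (I : submodClosed R^o).

Lemma ideal_mull (Q : submodClosed R^o) (a b : R) : b \in Q -> a * b \in Q.
Proof. exact: (rpredZ a). Qed.

Fact colon_closed (Q : submodClosed R^o) (c : R) :
  submod_closed (fun x : R^o => (x : R) * c \in Q).
Proof.
split=> [|r x y xc yc]; rewrite unfold_in.
  by rewrite mul0r; exact: rpred0.
rewrite mulrDl; apply: rpredD yc.
by rewrite -[_ * c]mulrA; exact: ideal_mull.
Qed.

(** Pigeonhole: a word of length at least [a + b] over [x :: s] has at least [a] letters equal to
    [x], or at least [b] letters different from [x], to which the induction hypothesis applies. *)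
Lemma word_nilpotent (s : seq R) (Q : submodClosed R^o) :
  (forall x, x \in s -> exists n, x ^+ n \in Q) ->
  exists m, forall w : seq R,
    all (fun x => x \in s) w -> (m <= size w)%N -> \prod_(x <- w) x \in Q.
Proof.
(* Over the empty alphabet the only word is empty, so the bound 1 makes this case vacuous. *)
elim: s => [|x s IH] sQ; first by exists 1%N => -[].
have [a xa] := sQ x (mem_head _ _).
have [b sb] := IH (fun y ys => sQ y (mem_behead (s := x :: s) ys)).
exists (a + b)%N => w ws abw.
rewrite (bigID (pred1 x)) /= -[X in _ * X]big_filter.
have [bw|wb] := leqP b (size [seq y <- w | y != x]).
  apply: ideal_mull; apply: sb bw.
  rewrite all_filter; apply: sub_all ws => y; rewrite inE.
  by move=> /orP[/eqP->|ys]; apply/implyP => //; rewrite eqxx.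
have aw : (a <= size [seq y <- w | y == x])%N.
  rewrite size_filter leqNgt; apply/negP => wa.
  have := count_predC (pred1 x) w; rewrite -(size_filter (predC _)) => E.
  by move: abw; rewrite -E leqNgt -addSn leq_add // ltnW.
rewrite mulrC; apply: ideal_mull; rewrite -big_filter.
have -> : \prod_(y <- [seq y <- w | y == x]) y =
    x ^+ size [seq y <- w | y == x].
  rewrite big_seq (eq_bigr (fun=> x)).
    by rewrite -big_seq big_const_seq count_predT iter_mulr_1.
  by move=> y; rewrite mem_filter => /andP[/eqP].
by rewrite -(subnK aw) exprD ideal_mull.
Qed.

(** The words of length [m] in the generators of [I] generate I^m. The induction removes one letter
    [x] by passing from [Q] to the colon ideal (Q : x). *)
Lemma ideal_exp_words (s : seq R^o) (Q : submodClosed R^o) m :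
  fg_by I s ->
  (forall w : seq R, all (fun x => x \in s) w -> size w = m ->
    \prod_(x <- w) x \in Q) ->
  {subset ideal_exp I m <= Q}.
Proof.
move=> sI; elim: m Q => [|m IH] Q wQ.
  move=> a _; rewrite -[a]mulr1 ideal_mull //.
  by have := wQ [::]; rewrite big_nil; apply.
apply: span_min => _ [a [b [aI bI ->]]].
suff : b \in mk_submod (colon_closed Q a) by rewrite mulrC.
move: bI; rewrite sI.
apply: (@span_min _ _ _ (mk_submod (colon_closed Q a))) => x xs.
rewrite unfold_in mulrC.
suff : a \in mk_submod (colon_closed Q x) by [].
apply: (IH (mk_submod (colon_closed Q x))) aI => w ws wm.
rewrite unfold_in mulrC; have := wQ (x :: w); rewrite big_cons; apply.
  by rewrite /= xs.
by rewrite /= wm.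
Qed.

Lemma ideal_exp_le m n : (m <= n)%N -> {subset ideal_exp I n <= ideal_exp I m}.
Proof.
move=> /subnK <-; elim: (n - m)%N => // k IH x xI; apply: IH.
exact: ideal_exp_sub xI.
Qed.

(** Powers are built one factor at a time on the right; the induction passes to (Q : b) and absorbs
    the last factor [b] into the element of I^m. *)
Lemma ideal_exp_addn m t (Q : submodClosed R^o) :
  (forall a b : R, a \in ideal_exp I m -> b \in ideal_exp I t -> a * b \in Q) ->
  {subset ideal_exp I (m + t) <= Q}.
Proof.
elim: m Q => [|m IH] Q mtQ; first by move=> b bI; rewrite -[b]mul1r mtQ.
apply: span_min => _ [a [b [aI bI ->]]].
suff : a \in mk_submod (colon_closed Q b) by [].
apply: (IH (mk_submod (colon_closed Q b))) aI => x y xI yI.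
rewrite unfold_in mulrAC mtQ //.
by apply: mem_span; exists x, b.
Qed.

Definition adic_open (V : lmodType R) (L : submodClosed V) : Prop :=
  exists m, forall (a : R) (v : V), a \in ideal_exp I m -> a *: v \in L.

(* [Q] is chosen maximal among the submodules containing [L] whose intersection
   with [K] lies in [L].  For [x] in [I] and [n] large, the chain of the
   [Q : x^n] is stationary, so [Q + x^n V] has the same property: hence
   [x^n V] lies in [Q]. *)
Lemma artin_rees (V : lmodType R) (K L : submodClosed V) :
  noetherian R -> noetherian_mod V ->
  (exists m, forall (a : R) v,
    a \in ideal_exp I m -> v \in K -> a *: v \in L) ->
  exists2 Q : submodClosed V, adic_open Q &
    forall v, v \in Q -> v \in K -> v \in L.
Proof.
move=> nR nV [m KL].
have [] := @noetherian_maximal R V (fun Q : submodClosed V =>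
  {subset L <= Q} /\ forall v, v \in Q -> v \in K -> v \in L) L nV.
  by split.
move=> Q [LQ QKL] Qmax; exists Q => //.
have [s sI] := nR I.
have nilp x : x \in s -> exists n, forall v : V, x ^+ n *: v \in Q.
  move=> xs.
  have xI n : x ^+ n \in ideal_exp I n.
    elim: n => // n IH; apply: mem_span; exists (x ^+ n), x; split=> //.
      by rewrite sI mem_span.
    by rewrite exprSr.
  have ccl n : submod_closed (fun v : V => x ^+ n *: v \in Q).
    split=> [|a u v uQ vQ]; first by rewrite unfold_in scaler0 rpred0.
    by rewrite unfold_in scalerDr rpredD // scalerA mulrC -scalerA rpredZ.
  have [N cN] : exists N, forall n,
      {subset mk_submod (ccl n) <= mk_submod (ccl N)}.
    apply: (@noetherian_acc _ _ (fun n => mk_submod (ccl n))) => // n v vQ.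
    by rewrite unfold_in exprS -scalerA rpredZ.
  (* From [N] on the chain of the (Q : x^n) is stationary; from [m] on x^n sends [K] into [L]. *)
  pose n := maxn N m; exists n => v.
  have cn k w : x ^+ k *: w \in Q -> x ^+ n *: w \in Q.
    move=> kw; have : w \in mk_submod (ccl N) by apply: (cN k).
    rewrite unfold_in => NwQ.
    by rewrite -(subnK (leq_maxl N m) : _ = n) exprD -scalerA rpredZ.
  have Qcl : submod_closed (fun u : V =>
      `[< exists q v, q \in Q /\ u = q + x ^+ n *: v >]).
    split=> [|a _ _ /asboolP[q [w [qQ ->]]] /asboolP[q' [w' [q'Q ->]]]];
      apply/asboolP.
      by exists 0, 0; rewrite rpred0 scaler0 addr0.
    exists (a *: q + q'), (a *: w + w'); split; first by rewrite rpredD ?rpredZ.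
    by rewrite !scalerDr addrACA !scalerA [a * _]mulrC.
  apply: (Qmax (mk_submod Qcl)).
  - split.
      move=> u /LQ uQ; apply/asboolP; exists u, 0; by rewrite scaler0 addr0.
    move=> k /asboolP[q [w [qQ kE]]] kK.
    (* Write k = q + x^n w. As x^n k is in [L], hence in [Q], so is x^(n+n) w; stationarity then
       brings x^n w back into [Q]. *)
    apply: QKL (kK); rewrite kE rpredD //; apply: (cn (n + n)%N).
    have : x ^+ n *: k \in Q.
      exact/LQ/(KL _ _ _ kK)/(ideal_exp_le (leq_maxr N m) (xI n)).
    rewrite kE scalerDr => kQ.
    rewrite exprD -scalerA -[X in X \in _](addKr (x ^+ n *: q)) rpredD //.
    by rewrite -scaleN1r !rpredZ.
  - by move=> u uQ; apply/asboolP; exists u, 0; rewrite scaler0 addr0.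
  - by apply/asboolP; exists 0, v; rewrite rpred0 add0r.
(* The ideal (Q : V) contains a power of each generator of [I], hence a power of [I]. *)
have acl : submod_closed (fun a : R^o =>
    `[< forall v : V, (a : R) *: v \in Q >]).
  split=> [|r a b /asboolP aQ /asboolP bQ]; apply/asboolP => v.
    by rewrite scale0r rpred0.
  by rewrite scalerDl rpredD // -scalerA rpredZ.
have [x xs|M wM] := @word_nilpotent s (mk_submod acl).
  by have [n xn] := nilp x xs; exists n; apply/asboolP.
exists M => a v aM.
have : a \in mk_submod acl.
  by apply: (ideal_exp_words sI) aM => w ws wE; apply: wM; rewrite ?wE.
by move=> /asboolP.
Qed.

End IdealPowers.

(** * Free modules and finite free covers *)

Section FreeModules.
Variable R : comNzRingType.

(** The projection modulo the span of the basis vanishes on the basis, hence everywhere. *)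
Lemma freemod_span (K : choiceType) (x : freemod R K) :
  x \in span (fun y => exists k, y = @fbasis R K k).
Proof.
set S := span _; suff : quotmod_pi S x == quotmod_pi S 0.
  by rewrite quotmod_pi_eq subr0.
apply/eqP; rewrite linear0.
apply: (@freemod_ext _ _ _ (quotmod_pi S) \0) => k.
apply/eqP; rewrite -[X in _ == X](linear0 (quotmod_pi S)) quotmod_pi_eq subr0.
by apply: mem_span; exists k.
Qed.

Lemma free_lift_mem (K : choiceType) (V : lmodType R) (Q : submodClosed V)
    (f : K -> V) x :
  (forall k, f k \in Q) -> free_lift f x \in Q.
Proof.
move=> fQ; have := freemod_span x.
apply: (@span_min _ _ _ (preim_pred (free_lift f) Q)) => _ [k ->].
by rewrite unfold_in free_lift_basis.
Qed.

Lemma freemod_fingen n : fingen (freemod R 'I_n).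
Proof.
exists [seq fbasis R i | i <- enum 'I_n] => v; have := freemod_span v.
apply: span_mono => _ [i ->]; apply/map_f.
by rewrite mem_enum.
Qed.

Lemma fingen_free_cover (V : lmodType R) : fingen V ->
  exists n (f : 'I_n -> V), forall v, exists x, free_lift f x = v.
Proof.
move=> [s sV]; exists (size s), (tnth (in_tuple s)) => v.
have := sV v; move: v {sV}.
suff sub : {subset span (fun x => x \in s) <=
    im_pred (free_lift (tnth (in_tuple s)))} by move=> v /sub/asboolP.
apply: span_min => x /(tnthP (in_tuple s))[i ->]; apply/asboolP.
by exists (fbasis R i); rewrite free_lift_basis.
Qed.

End FreeModules.

(** * Factoring syzygy maps up to maps that extend to the free module *)

Section Syzygies.
Variable R : comNzRingType.

(** The composites of [syz_incl] with a linear map are the maps that extend to the ambient free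
    module; in degree 0 only the zero map does, because F_(-1) = 0. *)
Definition syz_incl n (A : lmodType R) : {linear syz n A -> res_prev n A} :=
  if n is m.+1 then @submod_val R _ (ker_pred (free_eval (syz m A))) else \0.

Lemma res_dE n (A : lmodType R) x :
  res_d n A x = syz_incl n A (free_eval (syz n A) x).
Proof. by case: n x. Qed.

(** A factorization through [K] in degree [n] passes to one through ker p in degree n + 1. The new
    error term is the difference [psi] on free modules: evaluation kills it by the hypothesis in
    degree [n], so it lands in the next syzygy, and its summand through [res_d] vanishes on the
    syzygy of [A]. *)
Lemma syz_map_lift n (A B K P : lmodType R) (f : {linear A -> B})
    (p : {linear P -> K}) (u : {linear K -> syz n B})
    (w : {linear syz n A -> K}) (d : {linear res_prev n A -> syz n B})
    (u' : {linear P -> free (syz n B)}) (w' : {linear free (syz n A) -> P})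
    (u1 : {linear submod (ker_pred p) -> syz n.+1 B})
    (w1 : {linear syz n.+1 A -> submod (ker_pred p)}) :
  (forall x, syz_map n f x = u (w x) + d (syz_incl n A x)) ->
  (forall y, free_eval (syz n B) (u' y) = u (p y)) ->
  (forall z, p (w' z) = w (free_eval (syz n A) z)) ->
  (forall x, submod_val (u1 x) = u' (submod_val x)) ->
  (forall x, submod_val (w1 x) = w' (submod_val x)) ->
  exists d1 : {linear res_prev n.+1 A -> syz n.+1 B},
    forall x, syz_map n.+1 f x = u1 (w1 x) + d1 (syz_incl n.+1 A x).
Proof.
move=> fE u'E w'E u1E w1E.
(* The map [d] lifts along the evaluation because its source is free, or zero when n = 0. *)
have [d' d'E] : exists d' : {linear res_prev n A -> free (syz n B)},
    forall y, free_eval (syz n B) (d' y) = d y.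
  case: n d {u w u' w' u1 w1 fE u'E w'E u1E w1E} => [|n] d.
    by exists \0 => y; rewrite [y]thinmx0 !linear0.
  exists (free_lift (fun k => fbasis R (d (fbasis R k)))).
  apply: (@freemod_ext _ _ _ (free_eval _ \o free_lift _) d) => k /=.
  by rewrite !free_lift_basis.
pose psi : {linear free (syz n A) -> free (syz n B)} :=
  free_map (syz_map n f) \- (u' \o w') \- (d' \o res_d n A).
have psiK x : psi x \in ker_pred (free_eval (syz n B)).
  rewrite unfold_in /= !linearB /= -free_eval_map fE u'E w'E d'E.
  by rewrite res_dE -addrA -opprD subrr.
exists (corestrict psiK) => x; apply: val_inj => /=.
rewrite u1E w1E res_dE (eqP (submod_valP x)) linear0 linear0 subr0.
by rewrite addrC subrK.
Qed.

End Syzygies.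

(** * Approximating the syzygies of R/I^t by finitely generated modules *)

Section SyzygyApproximation.
Variables (R : comNzRingType) (I : submodClosed R^o).
Hypothesis nR : noetherian R.

(** The index is [k + t], not [t + k], so that recursion on [k] typechecks by conversion. *)
Fixpoint quot_exp_trans t k : {linear quot_exp I (k + t) -> quot_exp I t} :=
  if k is l.+1 then quot_exp_trans t l \o quot_exp_map I (l + t) else idfun.

Lemma quot_exp_trans_pi t k (a : R^o) :
  quot_exp_trans t k (quotmod_pi (ideal_exp I (k + t)) a) =
  quotmod_pi (ideal_exp I t) a.
Proof.
elim: k => //= k IH; rewrite -IH; congr (quot_exp_trans t k _).
exact: quotmod_map_pi.
Qed.

(** Views a submodule of the subtype [submod K] inside [V], where Artin-Rees is stated. *)
Definition sub_image (V : lmodType R) (K : submodClosed V)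
    (L : submodClosed (submod K)) : submodClosed V :=
  im_pred (@submod_val R V K \o @submod_val R (submod K) L).

Lemma sub_imageP (V : lmodType R) (K : submodClosed V)
    (L : submodClosed (submod K)) (x : submod K) :
  reflect (x \in L) (submod_val x \in sub_image L).
Proof.
apply: (iffP idP) => [/asboolP[[y yL] /= /val_inj <-] //|xL].
by apply/asboolP; exists (Submod xL).
Qed.

(** [K] and [u] are fixed before [L], since the [L] used later is the kernel of a map composed with
    [u]. *)
Definition syz_approximation t n : Prop :=
  exists (K : lmodType R) (u : {linear K -> syz n (quot_exp I t)}),
  fingen K /\ forall L : submodClosed K, adic_open I L ->
  exists k (w : {linear syz n (quot_exp I (k + t)) -> K})
    (d : {linear res_prev n (quot_exp I (k + t)) -> syz n (quot_exp I t)}),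
    (forall x, w x \in L) /\
    forall x, syz_map n (quot_exp_trans t k) x = u (w x) + d (syz_incl n _ x).

(** Here [K] is I^t, the kernel of R -> R/I^t. An open [L] contains I^m I^t, hence I^(m+t), through
    which the first syzygy of R/I^(m+t) maps, so k = m works. *)
Lemma syz_approximation1 t : syz_approximation t 1.
Proof.
pose p : {linear R^o -> quot_exp I t} := @quotmod_pi _ _ (ideal_exp I t).
have [u' u'E] : exists u' : {linear R^o -> free (quot_exp I t)},
    forall a, u' a = a *: fbasis R (p 1).
  have uL : linear (fun a : R^o => a *: fbasis R (p 1) : free (quot_exp I t)).
    by move=> a b c; rewrite scalerDl -scalerA.
  by exists (mk_linear uL).
have u'p a : free_eval (quot_exp I t) (u' a) = p a.
  rewrite u'E linearZ.
  have -> : free_eval (quot_exp I t) (fbasis R (p 1)) = p 1.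
    exact: free_lift_basis.
  by rewrite -linearZ; congr (p _); exact: mulr1.
have u1P (x : submod (ker_pred p)) :
    (u' \o @submod_val _ _ (ker_pred p)) x \in
      ker_pred (free_eval (quot_exp I t)).
  by rewrite unfold_in /= u'p (eqP (submod_valP x)).
exists (submod (ker_pred p)), (corestrict u1P); split.
  by have [s sK] := nR (ker_pred p); exact: fingen_submod sK.
move=> L [m Lm]; exists m.
pose A := quot_exp I (m + t).
(* Sending each basis element to a representative in [R] maps the kernel of the evaluation into
   I^(m+t). *)
pose w' : {linear free A -> R^o} := free_lift (fun x : A => repr x : R^o).
have w'E z : p (w' z) = quot_exp_trans t m (free_eval A z).
  move: z; apply: (@freemod_ext _ _ _ (p \o w')
    (quot_exp_trans t m \o free_eval A)) => x /=.
  rewrite !free_lift_basis -[X in quot_exp_trans _ _ X]quotmod_reprK.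
  by rewrite quot_exp_trans_pi.
have w'I z : quotmod_pi (ideal_exp I (m + t)) (w' z) = free_eval A z.
  move: z; apply: (@freemod_ext _ _ _
    (@quotmod_pi _ _ (ideal_exp I (m + t)) \o w') (free_eval A)) => x /=.
  by rewrite !free_lift_basis quotmod_reprK.
have w1P (x : syz 1 A) :
    (w' \o @submod_val _ _ (ker_pred (free_eval A))) x \in ker_pred p.
  by rewrite unfold_in /= w'E (eqP (submod_valP x)) linear0.
have [] := @syz_map_lift R 0 A (quot_exp I t) (quot_exp I t) R^o
  (quot_exp_trans t m) p idfun (quot_exp_trans t m) \0 u' w'
  (corestrict u1P) (corestrict w1P) => //.
  by move=> x /=; rewrite addr0.
move=> d dE; exists (corestrict w1P), d; split=> // x.
apply/sub_imageP => /=.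
have : w' (submod_val x) \in ideal_exp I (m + t).
  rewrite -[X in X \in _]subr0 -quotmod_pi_eq w'I linear0.
  exact: submod_valP x.
apply: ideal_exp_addn => a b aI bI.
have bK : b \in ker_pred p.
  by rewrite unfold_in -(linear0 p) /= quotmod_pi_eq subr0.
have /sub_imageP := Lm a (Submod bK) aI; exact.
Qed.

(** The new [K] is the kernel of a finite free cover p : P -> K. For [L] open in ker p, Artin-Rees
    gives an open [Q] in [P] whose intersection with ker p lies in [L]. As [p] is surjective, p(Q)
    is open in [K]; a map [w] into p(Q) lifts to [Q], and the lift sends the next syzygy into both
    [Q] and ker p, hence into [L]. *)
Lemma syz_approximationS t n :
  syz_approximation t n -> syz_approximation t n.+1.
Proof.
move=> [K [u [fgK Kw]]]; have [r [f fK]] := fingen_free_cover fgK.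
pose P := freemod R 'I_r; pose p : {linear P -> K} := free_lift f.
pose B := quot_exp I t.
pose u' : {linear P -> free (syz n B)} :=
  free_lift (fun i => fbasis R (u (f i))).
have u'E y : free_eval (syz n B) (u' y) = u (p y).
  move: y; apply: (@freemod_ext _ _ _ (free_eval _ \o u') (u \o p)) => i /=.
  by rewrite !free_lift_basis.
have u1P (x : submod (ker_pred p)) :
    (u' \o @submod_val _ _ (ker_pred p)) x \in ker_pred (free_eval (syz n B)).
  by rewrite unfold_in /= u'E (eqP (submod_valP x)) linear0.
have nP : noetherian_mod P.
  by apply: fingen_noetherian nR _; exact: freemod_fingen.
exists (submod (ker_pred p)), (corestrict u1P); split.
  by have [s sK] := nP (ker_pred p); exact: fingen_submod sK.
move=> L [m Lm].
have [|Q [l Ql] QL] := @artin_rees _ I P (ker_pred p) (sub_image L) nR nP.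
  exists m => a v aI vK; have /sub_imageP := Lm a (Submod vK) aI; exact.
have [|k [w [d [wQ dE]]]] := Kw (im_pred (p \o @submod_val _ _ Q)).
  exists l => a v aI; have [y <-] := fK v; apply/asboolP.
  pose y' : submod Q := Submod (Ql a y aI).
  by exists y'; exact: linearZ.
exists k; pose A := quot_exp I (k + t).
(* The preimages are taken inside [Q], so that the lift [w'] has all its values in [Q]. *)
have /choice[g gE] : forall x : syz n A,
    exists y : submod Q, p (submod_val y) = w x.
  by move=> x; have /asboolP := wQ x.
pose w' : {linear free (syz n A) -> P} := free_lift (fun x => submod_val (g x)).
have w'E z : p (w' z) = w (free_eval (syz n A) z).
  move: z; apply: (@freemod_ext _ _ _ (p \o w')
    (w \o free_eval (syz n A))) => x /=.
  by rewrite [free_lift_fun _ (fbasis R x)]free_lift_basis gE free_lift_basis.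
have w1P (x : syz n.+1 A) :
    (w' \o @submod_val _ _ (ker_pred (free_eval (syz n A)))) x \in ker_pred p.
  by rewrite unfold_in /= w'E (eqP (submod_valP x)) linear0.
have [//|//|//|//|//|d1 d1E] := @syz_map_lift R n A B K P
  (quot_exp_trans t k) p u w d u' w' (corestrict u1P) (corestrict w1P).
exists (corestrict w1P), d1; split=> // x.
apply/sub_imageP/QL; last exact: w1P.
by apply: free_lift_mem => y; exact: submod_valP.
Qed.

Lemma syz_approximable t n : syz_approximation t n.+1.
Proof.
elim: n => [|n]; first exact: syz_approximation1.
exact: syz_approximationS.
Qed.

End SyzygyApproximation.

(** * Maps out of quotients and direct limits *)

Lemma quotmod_lift (R : comNzRingType) (U V : lmodType R) (P : submodClosed U)
    (f : {linear U -> V}) : (forall u, u \in P -> f u = 0) ->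
  exists g : {linear quotmod P -> V}, forall u, g (quotmod_pi P u) = f u.
Proof.
move=> f0.
have repf u : f (repr (quotmod_pi P u)) = f u.
  apply/eqP; rewrite -subr_eq0 -linearB f0 //.
  by rewrite -quotmod_pi_eq quotmod_reprK.
have gL : linear (fun x : quotmod P => f (repr x)).
  move=> a x y; rewrite -[x]quotmod_reprK -[y]quotmod_reprK -linearP.
  by rewrite !repf linearP.
by exists (mk_linear gL).
Qed.

Section DirectLimits.
Variables (R : comNzRingType) (M : nat -> lmodType R).
Variable q : forall n, {linear M n -> M n.+1}.

Lemma dirlim_in_trans n (x : M n) : dirlim_in q (q n x) = dirlim_in q x.
Proof.
apply/esym/eqP; rewrite quotmod_pi_eq; apply: mem_span.
by exists n, x.
Qed.

Lemma prod_in_same n (x : M n) : prod_in x n = x.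
Proof. exact: dfwith_in. Qed.

Lemma prod_in_out n (x : M n) k : n != k -> prod_in x k = 0.
Proof. exact: dfwith_out. Qed.

Lemma dirlim_in_linear n : linear (@dirlim_in R M q n).
Proof.
move=> a x y; rewrite /dirlim_in -linearP; congr quotmod_pi.
apply: val_inj => /=; apply: functional_extensionality_dep => k.
have E : (a *: prod_in x + prod_in y) k = a *: prod_in x k + prod_in y k by [].
rewrite [RHS]E; have [nk|nk] := eqVneq n k; last first.
  by rewrite !prod_in_out // scaler0 addr0.
by case: k / nk {E}; rewrite !prod_in_same.
Qed.

Lemma dirlim_in0 n : dirlim_in q (0 : M n) = 0.
Proof. by have := linear0 (mk_linear (@dirlim_in_linear n)). Qed.

(** A family supported up to index N + 1 is its top component plus a family supported up to [N]; the
    latter comes from [M N] by induction and is pushed one step by [q]. *)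
Lemma dirlim_rep (z : dirlim q) : exists n (x : M n), z = dirlim_in q x.
Proof.
suff rep N (y : dirsum M) : (forall n, (N < n)%N -> submod_val y n = 0) ->
    exists x : M N, quotmod_pi _ y = dirlim_in q x.
  rewrite -[z]quotmod_reprK; have /asboolP[N zN] := submod_valP (repr z).
  have [n /ltnW|x ->] := rep N (repr z); first exact: zN.
  by exists N, x.
elim: N y => [|N IH] y yN.
  exists (submod_val y 0%N); congr quotmod_pi; apply: val_inj => /=.
  apply: functional_extensionality_dep => -[|k]; first by rewrite prod_in_same.
  by rewrite prod_in_out // yN.
have [n|x' x'E] := IH (y - dirsum_in (submod_val y N.+1)).
  have -> : submod_val (y - dirsum_in (submod_val y N.+1)) n =
      submod_val y n - prod_in (submod_val y N.+1) n by [].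
  rewrite leq_eqVlt => /predU1P[<-|nN]; first by rewrite prod_in_same subrr.
  by rewrite yN // prod_in_out ?subrr // ltn_eqF.
exists (q N x' + submod_val y N.+1).
have := dirlim_in_linear 1 (q N x') (submod_val y N.+1).
rewrite !scale1r => ->; rewrite dirlim_in_trans -x'E linearB /=.
by rewrite -[dirlim_in q _]/(quotmod_pi _ (dirsum_in _)) subrK.
Qed.

(** On the direct sum the map adds up the [phi n] below a chosen bound [b y] of the support; by [SE]
    any other bound gives the same sum, whence linearity. *)
Lemma dirlim_lift (V : lmodType R) (phi : forall n, {linear M n -> V}) :
  (forall n x, phi n.+1 (q n x) = phi n x) ->
  exists g : {linear dirlim q -> V}, forall n x, g (dirlim_in q x) = phi n x.
Proof.
move=> phiq.
pose c (y : dirsum M) : prodmod M := submod_val y.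
pose S N (y : dirsum M) : V := \sum_(n < N) phi n (c y n).
have SE N K y : (N <= K)%N -> (forall n, (N <= n)%N -> c y n = 0) ->
    S K y = S N y.
  move=> /subnKC <- yN; rewrite /S big_split_ord /= [X in _ + X]big1 ?addr0 //.
  by move=> i _; rewrite yN ?linear0 // leq_addr.
have /choice[b bP] : forall y : dirsum M,
    exists N, forall n, (N <= n)%N -> c y n = 0.
  by move=> y; have /asboolP := submod_valP y.
have bE y N : (forall n, (N <= n)%N -> c y n = 0) -> S (b y) y = S N y.
  move=> yN; rewrite -(SE _ (maxn (b y) N) _ (leq_maxl _ _) (bP y)).
  exact: SE (leq_maxr _ _) yN.
have SL : linear (fun y : dirsum M => S (b y) y).
  move=> a u v; pose N := maxn (b (a *: u + v)) (maxn (b u) (b v)).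
  rewrite -(SE _ N _ (leq_maxl _ _) (bP (a *: u + v))).
  have uN : (b u <= N)%N by rewrite /N maxnCA leq_maxl.
  have vN : (b v <= N)%N by rewrite /N maxnA leq_maxr.
  rewrite -(SE _ N _ uN (bP u)) -(SE _ N _ vN (bP v)).
  rewrite /S scaler_sumr -big_split /=; apply: eq_bigr => i _.
  exact: (linearP (phi i)).
have Sin n (x : M n) : S (b (dirsum_in x)) (dirsum_in x) = phi n x.
  rewrite (bE _ n.+1) => [|k nk /=]; last by rewrite prod_in_out // ltn_eqF.
  rewrite /S big_ord_recr /= prod_in_same big1 ?add0r // => i _.
  by rewrite prod_in_out ?linear0 // gtn_eqF.
have [|g gE] := @quotmod_lift _ _ _ (span (dirlim_rel q)) (mk_linear SL).
  move=> y yS; apply/eqP; move: y yS.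
  apply: (@span_min _ _ _ (ker_pred (mk_linear SL))) => _ [n [x ->]].
  by rewrite unfold_in linearB /= !Sin phiq subrr.
by exists g => n x; rewrite gE -Sin.
Qed.

End DirectLimits.

(** * Torsion modules, and torsion of formal local homology *)

Section Torsion.
Variable R : comNzRingType.

Definition torsion (I : submodClosed R^o) (N : lmodType R) : Prop :=
  forall y : N, exists t, forall a : R, a \in ideal_exp I t -> a *: y = 0.

Lemma tensor_annihilated (A B : lmodType R) (a : R) :
  (forall b : B, a *: b = 0) -> forall x : tensor A B, a *: x = 0.
Proof.
move=> aB x.
have aL : linear (fun x : tensor A B => a *: x).
  by move=> c u v; rewrite scalerDr !scalerA mulrC.
apply: (@tensor_ext _ _ _ _ (mk_linear aL) \0) => u b /=.
have <- : tens u (a *: b) = a *: tens u b.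
  apply/eqP; rewrite /tens -linearZ quotmod_pi_eq; apply: mem_span.
  exact: tensor_relZr.
(* The vanishing of the tensor of [u] with 0 is the scalar relation for the scalar 0. *)
have <- : (0 : R) *: tens u b = 0 by rewrite scale0r.
rewrite aB -[X in tens u X](scale0r b).
apply/eqP; rewrite /tens -linearZ quotmod_pi_eq; apply: mem_span.
exact: tensor_relZr.
Qed.

Lemma tor_annihilated i (A B : lmodType R) (a : R) :
  (forall b : B, a *: b = 0) -> forall x : tor i A B, a *: x = 0.
Proof.
move=> aB; case: i => n x; last by rewrite [a *: x]thinmx0.
rewrite -[x]quotmod_reprK -linearZ -[RHS](linear0 (quotmod_pi _)).
congr quotmod_pi; apply: val_inj => /=.
exact: tensor_annihilated.
Qed.

(** Each element comes from some stage [t], an inverse limit of Tor modules whose second argument is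
    killed by I^t. *)
Lemma formal_local_homology_torsion (I J : submodClosed R^o) j
    (M : lmodType R) :
  torsion I (formal_local_homology I J j M).
Proof.
move=> y; have [t [x ->]] := dirlim_rep y; exists t => a aI.
have ax0 : a *: x = 0.
  apply: val_inj; apply: functional_extensionality_dep => k.
  apply: (tor_annihilated (a := a)) => b; apply: val_inj => /=.
  by have /asboolP := submod_valP b; apply.
have dL := @dirlim_in_linear R _
  (fun t => local_homology_map J j (annihilated_incl I M t)) t.
have := linearZ_LR (mk_linear dL) a x; rewrite /= ax0 => <-.
exact: dirlim_in0.
Qed.

(** One power of [I] kills the images of the finitely many generators. *)
Lemma torsion_kernel_open (I : submodClosed R^o) (K N : lmodType R)
    (f : {linear K -> N}) :
  fingen K -> torsion I N -> adic_open I (ker_pred f).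
Proof.
move=> [s sK] tN.
have [m sm] : exists m, forall x, x \in s ->
    forall a : R, a \in ideal_exp I m -> a *: f x = 0.
  elim: s {sK} => [|x s [m IH]]; first by exists 0%N.
  have [t xt] := tN (f x); exists (maxn t m) => y.
  rewrite inE => /predU1P[->|ys] a aI.
    by apply: xt; exact: ideal_exp_le (leq_maxl _ _) _ aI.
  by apply: IH => //; exact: ideal_exp_le (leq_maxr _ _) _ aI.
exists m => a v aI.
have aL : linear (fun x : K => a *: f x).
  by move=> c u w; rewrite linearP scalerDr !scalerA mulrC.
rewrite unfold_in linearZ; have := sK v.
apply: (@span_min _ _ _ (ker_pred (mk_linear aL))) => x xs.
by rewrite unfold_in /= sm.
Qed.

End Torsion.

(** * Ext classes represented by cocycles *)

Section ExtClasses.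
Variable R : comNzRingType.

Fact hom_of_subproof (U V : lmodType R) (f : {linear U -> V}) :
  (f : U -> V) \in @linear_pred R U V.
Proof. by apply/asboolP; exact: linearP. Qed.

Definition hom_of (U V : lmodType R) (f : {linear U -> V}) : hom U V :=
  Submod (hom_of_subproof f).

Lemma hom_rep (U V : lmodType R) (h : hom U V) :
  exists f : {linear U -> V}, h = hom_of f.
Proof.
by exists (mk_linear (asboolW (submod_valP h))); apply: val_inj.
Qed.

Variables (n : nat) (N : lmodType R).

Definition cocycle (A : lmodType R) (f : {linear res n A -> N}) : Prop :=
  forall x, f (res_d n.+1 A x) = 0.

Lemma cocycle_ker A (f : {linear res n A -> N}) : cocycle f ->
  hom_of f \in ker_pred (hom_map N (res_d n.+1 A)).
Proof.
move=> fd; rewrite unfold_in; apply/eqP/val_inj/funext => x; exact: fd.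
Qed.

Definition ext_class A (f : {linear res n A -> N}) (fd : cocycle f) :
    ext_nat n A N :=
  quotmod_pi _ (Submod (cocycle_ker fd)).

Lemma eq_ext_class A (f g : {linear res n A -> N})
    (fd : cocycle f) (gd : cocycle g) :
  f =1 g -> ext_class fd = ext_class gd.
Proof.
by move=> fg; congr quotmod_pi; do 2!apply: val_inj => /=; apply: funext.
Qed.

Lemma ext_class_rep A (z : ext_nat n A N) :
  exists (f : {linear res n A -> N}) (fd : cocycle f), z = ext_class fd.
Proof.
rewrite -[z]quotmod_reprK; case: (repr z) => h hd.
have [f hf] := hom_rep h; rewrite {}hf in hd *.
have fd : cocycle f.
  move=> x.
  have /eqP/(congr1 (@submod_val _ _ _))/(congr1 (fun k => k x)) := hd.
  exact.
by exists f, fd; congr quotmod_pi; apply: val_inj.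
Qed.

Lemma ext_class_eq0 A (f : {linear res n A -> N}) (fd : cocycle f)
    (g : {linear res_prev n A -> N}) :
  (forall x, f x = g (res_d n A x)) -> ext_class fd = 0.
Proof.
move=> fg; rewrite -(linear0 (quotmod_pi _)); apply/eqP.
rewrite quotmod_pi_eq subr0; apply/asboolP; exists (hom_of g).
by apply: val_inj; apply: funext => x /=; rewrite fg.
Qed.

Lemma ext_class_map (A B : lmodType R) (g : {linear A -> B})
    (f : {linear res n B -> N})
    (fd : cocycle f) (fgd : cocycle (f \o res_map n g)) :
  ext_nat_map n N g (ext_class fd) = ext_class fgd.
Proof.
rewrite /ext_class [LHS]quotmod_map_pi; congr quotmod_pi.
by do 2!apply: val_inj => /=.
Qed.

Lemma cocycle_map (A B : lmodType R) (g : {linear A -> B})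
    (f : {linear res n B -> N}) :
  cocycle f -> cocycle (f \o res_map n g).
Proof.
move=> fd x /=; have /= -> := res_d_map (n := n.+1) g x; exact: fd.
Qed.

End ExtClasses.

(** * Local cohomology of torsion modules *)

Section LocalCohomology.
Variables (R : comNzRingType) (I : submodClosed R^o).

Lemma syz_map_id n (A : lmodType R) : syz_map n (idfun : {linear A -> A}) =1 id.
Proof.
elim: n => [|n IH] x; first by [].
apply: val_inj => /=; apply: (@freemod_ext _ _ _ (free_map _) idfun) => k /=.
by rewrite free_lift_basis IH.
Qed.

Lemma res_map_id n (A : lmodType R) : res_map n (idfun : {linear A -> A}) =1 id.
Proof.
apply: (@freemod_ext _ _ _ (res_map n idfun) idfun) => k /=.
by rewrite free_lift_basis syz_map_id.
Qed.

Lemma res_map_comp n (A B C : lmodType R) (f : {linear A -> B})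
    (g : {linear B -> C}) x :
  res_map n (g \o f) x = res_map n g (res_map n f x).
Proof.
have := @res_map_square R n A B C C f g (g \o f) idfun (fun=> erefl) x.
by rewrite res_map_id.
Qed.

(** Lets a class be replaced by its pullback [k] stages later, where it may become a coboundary. *)
Lemma dirlim_ext_class n (N : lmodType R) t k
    (f : {linear res n (quot_exp I t) -> N}) (fd : cocycle f) :
  dirlim_in (fun s => ext_nat_map n N (quot_exp_map I s)) (ext_class fd) =
  dirlim_in (fun s => ext_nat_map n N (quot_exp_map I s))
    (ext_class (cocycle_map (quot_exp_trans I t k) fd)).
Proof.
elim: k => [|k ->].
  congr dirlim_in; apply: eq_ext_class => x /=.
  by rewrite -[in LHS](res_map_id x).
rewrite -dirlim_in_trans; congr dirlim_in.
rewrite (ext_class_map _ (cocycle_map (quot_exp_map I (k + t))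
  (cocycle_map (quot_exp_trans I t k) fd))).
by apply: eq_ext_class => x /=; rewrite res_map_comp.
Qed.

Lemma local_cohomology_torsion_eq0 n (N : lmodType R) :
  noetherian R -> torsion I N ->
  forall z : local_cohomology I n.+1 N, z = 0.
Proof.
move=> nR tN z; have [t [y ->]] := dirlim_rep z.
have [f [fd {y}->]] := ext_class_rep y.
pose S := syz n.+1 (quot_exp I t).
(* A cocycle kills the image of the next differential, which by exactness is the kernel of the
   evaluation, so it factors through the syzygy. *)
have [g gE] : exists g : {linear S -> N},
    forall x, f x = g (free_eval S x).
  have f0 x : free_eval S x = 0 -> f x = 0.
    by move=> /syz_exact[y <-]; exact: fd.
  have evb (x : S) : free_eval S (fbasis R x) = x by exact: free_lift_basis.
  have gL : linear (fun x : S => f (fbasis R x)).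
    move=> a u v; apply/eqP; rewrite -subr_eq0 -linearP -linearB f0 //.
    by rewrite linearB linearP !evb subrr.
  exists (mk_linear gL).
  apply: (@freemod_ext _ _ _ f (mk_linear gL \o free_eval S)) => x /=.
  by rewrite [free_lift_fun _ _]evb.
have [K [u [fgK Kw]]] := syz_approximable I nR t n.
have [k [w [d [wL dE]]]] := Kw _ (torsion_kernel_open (g \o u) fgK tN).
rewrite (dirlim_ext_class k fd).
rewrite (@ext_class_eq0 R _ N _ _ _ (g \o d)).
  exact: dirlim_in0.
(* Since g u w = 0, only the error term survives, and it exhibits the cocycle as the coboundary of g
   d. *)
move=> x; rewrite [LHS]gE -[free_eval _ _](free_eval_map (syz_map n.+1 _)).
rewrite dE linearD res_dE; have /eqP/= -> := wL (free_eval _ x).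
by rewrite add0r.
Qed.

(** The isomorphism evaluates a cocycle at the basis element of the class of 1. *)
Lemma local_cohomology0_torsion (N : lmodType R) :
  torsion I N -> lmod_isomorphic (local_cohomology I 0 N) N.
Proof.
move=> tN.
pose e t : quot_exp I t := quotmod_pi (ideal_exp I t) 1.
(* Both arguments of [f] evaluate to the same class in R/I^t, so they differ by a boundary, which a
   cocycle kills. Hence the value at [e t] determines [f]. *)
have fE t (f : {linear res 0 (quot_exp I t) -> N}) (fd : cocycle f) x :
    f x = repr (free_eval (quot_exp I t) x) *: f (fbasis R (e t)).
  apply/eqP; rewrite -subr_eq0 -linearZ -linearB.
  have /syz_exact[y <-] : free_eval (syz 0 (quot_exp I t))
      (x - repr (free_eval (quot_exp I t) x) *: fbasis R (e t)) = 0.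
    rewrite linearB linearZ.
    have -> : free_eval (syz 0 (quot_exp I t)) (fbasis R (e t)) = e t.
      exact: free_lift_basis.
    rewrite /e -linearZ; set r := repr _.
    have -> : r *: (1 : R^o) = r by exact: mulr1.
    by rewrite [X in _ - X]quotmod_reprK subrr.
  by rewrite fd.
have phi_ex t :
    exists phi : {linear ext_nat 0 (quot_exp I t) N -> N},
    forall f (fd : cocycle f), phi (ext_class fd) = f (fbasis R (e t)).
  pose ev1 (z : cycles (hom_map N (res_d 1 (quot_exp I t)))) : N :=
    submod_val (submod_val z) (fbasis R (e t)).
  have evL : linear ev1 by [].
  have [|phi phiE] := @quotmod_lift _ _ _
    (boundaries (hom_map N (res_d 0 (quot_exp I t)))
      (hom_map N (res_d 1 (quot_exp I t)))) (mk_linear evL).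
    move=> z /asboolP[h hz].
    rewrite /= /ev1 -hz /=.
    have [g ->] := hom_rep h; exact: (linear0 g).
  by exists phi => f fd; rewrite phiE.
pose phi t := sval (cid (phi_ex t)).
have phiE t := svalP (cid (phi_ex t)) :
  forall f (fd : cocycle f), phi t (ext_class fd) = _.
have [|g gE] := @dirlim_lift R _
  (fun s => ext_nat_map 0 N (quot_exp_map I s)) N phi.
  move=> t z; have [f [fd ->]] := ext_class_rep z.
  rewrite (ext_class_map _ (cocycle_map (quot_exp_map I t) fd)) !phiE /=.
  rewrite free_lift_basis; congr (f (fbasis R _)); exact: quotmod_map_pi.
exists g; apply: bijective_of_ker0 => [z|y].
  have [t [x ->]] := dirlim_rep z; have [f [fd ->]] := ext_class_rep x.
  rewrite [LHS]gE phiE => f1.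
  rewrite (@ext_class_eq0 R _ N _ _ _ \0); last first.
    by move=> w; rewrite fE // f1 scaler0.
  exact: dirlim_in0.
have [t yt] := tN y.
(* Surjectivity: as I^t kills [y], multiplication into [y] factors through R/I^t and gives a cocycle
   with value [y]. *)
have yL : linear (fun a : R^o => a *: y).
  by move=> a b c; rewrite scalerDl scalerA.
have [a aI|h hE] := @quotmod_lift R R^o N (ideal_exp I t) (mk_linear yL).
  exact: yt.
have hd : cocycle
    (h \o free_eval (quot_exp I t) : {linear res 0 (quot_exp I t) -> N}).
  move=> x /=.
  have /= -> := eqP (submod_valP (free_eval (syz 1 (quot_exp I t)) x)).
  exact: linear0.
exists (dirlim_in _ (ext_class hd)).
by rewrite [LHS]gE phiE /= free_lift_basis hE /= scale1r.
Qed.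

End LocalCohomology.

Theorem theorem2p3 (R : comNzRingType) (m I J : submodClosed R^o)
    (M : lmodType R) :
  noetherian R -> local_ring m ->
  forall j i : int,
    lmod_isomorphic
      (local_cohomology I i (formal_local_homology I J j M))
      (if i == 0 then formal_local_homology I J j M else zero_mod R).
Proof.
move=> nR _ j i; have tF := @formal_local_homology_torsion R I J j M.
have iso0 (V : lmodType R) :
    (forall z : V, z = 0) -> lmod_isomorphic V (zero_mod R).
  move=> V0; exists \0; apply: bijective_of_ker0 => // v.
  by exists 0; rewrite [v]thinmx0.
case: i => [[|n]|n] /=; first by exact: local_cohomology0_torsion.
  exact/iso0/local_cohomology_torsion_eq0.
(* For negative [i] every term of the direct system is the zero module. *)
apply: iso0 => z; have [t [x ->]] := dirlim_rep z.
rewrite [x]thinmx0.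
exact: dirlim_in0.
Qed.
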